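(* Let $\underline{P}:\mathcal{D}\to\mathbb{R}$ be $2$-convex on $\mathcal{D}$, a set of conditional gambles. If $\underline{P}(Y|D)<\inf(Y|D)$ for some $Y|D\in\mathcal{D}$, then $\underline{P}(X|B)\leq\sup(X|B)$ for all $X|B\in\mathcal{D}$. Similarly, if $\underline{P}(Y|D)>\sup(Y|D)$ for some $Y|D\in\mathcal{D}$, then $\underline{P}(X|B)\geq\inf(X|B)$ for all $X|B\in\mathcal{D}$.
   Context: Fix a partition $\mathbb{P}$ of the sure event into atoms $\omega$. A gamble is a bounded function $X:\mathbb{P}\to\mathbb{R}$. Events are subsets of $\mathbb{P}$, identified with their indicators; $\vee$ denotes union. For a gamble $X$ and an event $B\neq\varnothing$, the conditional gamble $X|B$ is the restriction of $X$ to $B$; thus $\sup(X|B)=\sup_{\omega\in B}X(\omega)$ and $\inf(X|B)=\inf_{\omega\in B}X(\omega)$. $\underline{P}:\mathcal{D}\to\mathbb{R}$ is $2$-convex on $\mathcal{D}$ iff for all $X_0|B_0,X_1|B_1\in\mathcal{D}$, $\sup\{B_1(X_1-\underline{P}(X_1|B_1))-B_0(X_0-\underline{P}(X_0|B_0))\,|\,B_0\vee B_1\}\geq 0$. *)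

(* Defs.v *)
From HB Require Import structures.
From mathcomp Require Import all_boot all_order all_algebra.
From mathcomp Require Import all_classical all_reals all_analysis.
Import Order.TTheory GRing.Theory Num.Theory.
Import numFieldNormedType.Exports.

Set Implicit Arguments.
Unset Strict Implicit.
Unset Printing Implicit Defensive.

Local Open Scope classical_set_scope.
Local Open Scope ring_scope.

(* MathComp-Analysis.  The type T is the partition of the sure event: its
   elements are the atoms, and events are sets of atoms. *)

Record gamble (R : realType) (T : Type) := Gamble {
  gamble_fun :> T -> R ;
  gamble_bounded : bounded_fun gamble_fun }.

Record nonempty_event (T : Type) := NonemptyEvent {
  event_set :> set T ;
  event_neq0 : event_set !=set0 }.

(* The domain of the function is the subtype of atoms in the conditioning
   event, so that X|B and X'|B are equal as soon as X and X' agree on B. *)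
Record cond_gamble (R : realType) (T : Type) := CondGamble {
  cg_event : nonempty_event T ;
  cg_fun :> set_type cg_event -> R ;
  cg_bounded : bounded_fun cg_fun }.

Lemma sigL_bounded (R : realType) (T : Type) (X : gamble R T) (B : set T) :
  bounded_fun (sigL B X).
Proof.
have [M [Mreal XM]] := gamble_bounded X.
by exists M; split => // x Mx w _; exact: XM.
Qed.

Definition conditional (R : realType) (T : Type) (X : gamble R T)
    (B : nonempty_event T) : cond_gamble R T :=
  @CondGamble R T B (sigL B X) (@sigL_bounded R T X B).

Notation "X \| B" := (conditional X B)
  (at level 40, no associativity).

Definition cg_sup (R : realType) (T : Type) (Z : cond_gamble R T) : R :=
  sup (range Z).

Definition cg_inf (R : realType) (T : Type) (Z : cond_gamble R T) : R :=
  inf (range Z).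

(* The map P is total; its values outside D are irrelevant. *)
Definition two_convex (R : realType) (T : Type) (D : set (cond_gamble R T))
    (P : cond_gamble R T -> R) : Prop :=
  forall (X0 X1 : gamble R T) (B0 B1 : nonempty_event T),
    D (X0 \| B0) -> D (X1 \| B1) ->
    sup [set \1_B1 w * (X1 w - P (X1 \| B1)) - \1_B0 w * (X0 w - P (X0 \| B0))
        | w in B0 `|` B1] >= 0.

(* Main.v *)
Require Import Defs.
From mathcomp Require Import all_boot all_order all_algebra.
From mathcomp Require Import all_classical all_reals all_analysis.
From mathcomp Require Import lra.
Import Order.TTheory GRing.Theory Num.Theory.
Import numFieldNormedType.Exports.
Local Open Scope classical_set_scope.
Local Open Scope ring_scope.

(** A price below the infimum of one conditional gamble and a price above the supremum of another
    cannot coexist: selling the first and buying the second loses a uniformly positive amount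
    wherever either bet is active, so the supremum in 2-convexity would be negative.
    [two_convex_le_sup] excludes this pair, and both halves of the theorem are readings of that
    exclusion. *)

Lemma conditional_le_sup (R : realType) (T : Type) (X : gamble R T)
    (B : nonempty_event T) (w : T) :
  w \in event_set B -> X w <= cg_sup (X \| B).
Proof.
move=> Bw; apply: ub_le_sup.
  exact/bounded_fun_has_ubound/cg_bounded.
by exists (SigSub Bw).
Qed.

Lemma conditional_ge_inf (R : realType) (T : Type) (X : gamble R T)
    (B : nonempty_event T) (w : T) :
  w \in event_set B -> cg_inf (X \| B) <= X w.
Proof.
move=> Bw; apply: ge_inf.
  exact/bounded_fun_has_lbound/cg_bounded.
by exists (SigSub Bw).
Qed.

Lemma two_convex_le_sup (R : realType) (T : Type) (D : set (cond_gamble R T))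
    (P : cond_gamble R T -> R) (X0 X1 : gamble R T)
    (B0 B1 : nonempty_event T) :
  two_convex D P -> D (X0 \| B0) -> D (X1 \| B1) ->
  P (X0 \| B0) < cg_inf (X0 \| B0) -> P (X1 \| B1) <= cg_sup (X1 \| B1).
Proof.
move=> hP D0 D1 lt0; rewrite leNgt; apply/negP => lt1.
have := hP X0 X1 B0 B1 D0 D1; apply/negP; rewrite -ltNge.
(* Buying [X1|B1] and selling [X0|B0] loses at least [- m] at every atom of
   [B0 `|` B1]. *)
set m := Num.max (cg_sup (X1 \| B1) - P (X1 \| B1))
                 (P (X0 \| B0) - cg_inf (X0 \| B0)).
apply: (@le_lt_trans _ _ m); last by rewrite gt_max !subr_lt0 lt0 lt1.
(* An atom is needed because [sup] of the empty set is 0, which exceeds the negative [m]. *)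
have [b B0b] := event_neq0 B0.
apply: ge_sup; first by eexists; exists b; [left | reflexivity].
move=> _ [w B01w <-]; rewrite le_max !indicE.
(* Each active bet contributes a loss. Where both are active, the sale only adds to the loss on the
   purchase, so the first bound still serves. *)
have [/(@conditional_le_sup _ _ X1) le1|B1w] := boolP (w \in event_set B1);
  have [/(@conditional_ge_inf _ _ X0) le0|B0w] := boolP (w \in event_set B0);
  rewrite ?mulr0n ?mulr1n ?mul0r ?mul1r.
- by apply/orP; left; lra.
- by apply/orP; left; lra.
- by apply/orP; right; lra.
- by case: B01w => /mem_set; [rewrite (negbTE B0w)|rewrite (negbTE B1w)].
Qed.

Theorem proposition7 (R : realType) (T : Type) (D : set (cond_gamble R T))
    (P : cond_gamble R T -> R) (hP : two_convex D P) :
  ((exists (Y : gamble R T) (E : nonempty_event T),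
       D (Y \| E) /\ P (Y \| E) < cg_inf (Y \| E)) ->
   forall (X : gamble R T) (B : nonempty_event T),
     D (X \| B) -> P (X \| B) <= cg_sup (X \| B)) /\
  ((exists (Y : gamble R T) (E : nonempty_event T),
       D (Y \| E) /\ P (Y \| E) > cg_sup (Y \| E)) ->
   forall (X : gamble R T) (B : nonempty_event T),
     D (X \| B) -> P (X \| B) >= cg_inf (X \| B)).
Proof.
split=> [[Y [E [DY ltY]]] X B DX|[Y [E [DY ltY]]] X B DX].
  exact: two_convex_le_sup hP DY DX ltY.
(* By contraposition the roles swap: [X] becomes the underpriced gamble and [Y] the one whose price
   must stay below its supremum. *)
rewrite leNgt; apply: contraTN ltY; rewrite -leNgt.
exact: two_convex_le_sup hP DX DY.
Qed.
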